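(* Every multilinear polynomial identity of degree $\le 7$ satisfied by the partially alternating ternary sum (over $\mathbb{Q}$) is a consequence of the four identities $P\equiv 0$, $Q\equiv 0$, $R\equiv 0$ and $S\equiv 0$, where (writing $(xyz)$ for $(x,y,z)$) $$P(a,b,c)=(abc)+(acb),\qquad Q(a,b,c,d,e)=(a(bcd)e)+(a(cbd)e),$$ $$R(a,b,c,d,e,f,g)=\frac1{12}\sum_{\sigma\in S_6}\epsilon(\sigma)\,((a(b^\sigma c^\sigma d^\sigma)e^\sigma)f^\sigma g^\sigma)-\frac1{12}\sum_{\sigma\in S_6}\epsilon(\sigma)\,((ab^\sigma c^\sigma)(d^\sigma e^\sigma f^\sigma)g^\sigma),$$ with $S_6$ acting on $\{b,c,d,e,f,g\}$, and $$S(a,b,c,d,e,f,g)=\frac14\sum_{\sigma\in S_5}\epsilon(\sigma)(((ab^\sigma c^\sigma)d^\sigma g)e^\sigma f^\sigma)-\frac16\sum_{\sigma\in S_5}\epsilon(\sigma)((a(b^\sigma c^\sigma d^\sigma)e^\sigma)f^\sigma g)+\frac14\sum_{\sigma\in S_5}\epsilon(\sigma)((a(b^\sigma c^\sigma g)d^\sigma)e^\sigma f^\sigma)$$ $$\qquad+\frac1{12}\sum_{\sigma\in S_5}\epsilon(\sigma)((ab^\sigma c^\sigma)(d^\sigma e^\sigma f^\sigma)g)-\frac16\sum_{\sigma\in S_5}\epsilon(\sigma)(a((b^\sigma c^\sigma d^\sigma)e^\sigma g)f^\sigma)-\frac1{12}\sum_{\sigma\in S_5}\epsilon(\sigma)(a(b^\sigma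 c^\sigma d^\sigma)(e^\sigma f^\sigma g)),$$ with $S_5$ acting on $\{b,c,d,e,f\}$.
   Context: The base field is $\mathbb{Q}$. An (associative) dialgebra is a vector space $A$ with two bilinear products $\dashv,\vdash$ satisfying $(a\dashv b)\dashv c=a\dashv(b\dashv c)$, $(a\vdash b)\vdash c=a\vdash(b\vdash c)$, $(a\vdash b)\dashv c=a\vdash(b\dashv c)$, $(a\dashv b)\vdash c=(a\vdash b)\vdash c$, $a\dashv(b\dashv c)=a\dashv(b\vdash c)$. The partially alternating ternary sum (PATS) is the trilinear operation on a dialgebra $$[a,b,c]=a\dashv b\dashv c-a\dashv c\dashv b-b\vdash a\dashv c+c\vdash a\dashv b+b\vdash c\vdash a-c\vdash b\vdash a .$$ A ternary algebra is a vector space with a trilinear product $(\cdot,\cdot,\cdot)$. A (ternary) polynomial of degree $n$ is a linear combination of monomials of degree $n$ in the free (nonassociative) ternary algebra on a set of variables; it is multilinear if each of $n$ variables occurs exactly once in each monomial. A polynomial identity $f\equiv 0$ is satisfied by the PATS if $f$ vanishes for all values of the variables in every dialgebra when $(\cdot,\cdot,\cdot)$ is interpreted as the PATS. An identity is a consequence of a set of identities if it holds in every ternary algebra over $\mathbb{Q}$ satisfying all the identities of that set. Here $\epsilon(\sigma)$ is the sign of $\sigma$ and $x^\sigma$ is the image of the variable $x$ under $\sigma$. *)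

(* Defs.v *)
From HB Require Import structures.
From mathcomp Require Import all_boot all_order all_algebra all_fingroup.
From mathcomp Require Import sesquilinear.
From mathcomp.multinomials Require Import freeg.

Set Implicit Arguments.
Unset Strict Implicit.
Unset Printing Implicit Defensive.

Import GRing.Theory.
Local Open Scope ring_scope.

Record ternaryAlgebra := TernaryAlgebra {
  ternary_sort :> lmodType rat;
  tprod : ternary_sort -> ternary_sort -> ternary_sort -> ternary_sort;
  tprod_linear1 : forall y z, linear (fun x => tprod x y z);
  tprod_linear2 : forall x z, linear (fun y => tprod x y z);
  tprod_linear3 : forall x y, linear (fun z => tprod x y z)
}.

Record dialgebra := Dialgebra {
  dialgebra_sort :> lmodType rat;
  dleft : {bilinear dialgebra_sort -> dialgebra_sort -> dialgebra_sort};
  dright : {bilinear dialgebra_sort -> dialgebra_sort -> dialgebra_sort};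
  dleftA : forall a b c, dleft (dleft a b) c = dleft a (dleft b c);
  drightA : forall a b c, dright (dright a b) c = dright a (dright b c);
  dinnerA : forall a b c, dleft (dright a b) c = dright a (dleft b c);
  dright_bar : forall a b c, dright (dleft a b) c = dright (dright a b) c;
  dleft_bar : forall a b c, dleft a (dleft b c) = dleft a (dright b c)
}.

Local Notation "x ⊣ y" := (dleft _ x y) (at level 40, left associativity).
Local Notation "x ⊢ y" := (dright _ x y) (at level 40, left associativity).

(* The unparenthesised triple products of the PATS are unambiguous by dleftA,
   drightA and dinnerA; they are read here as left-associated. *)
Definition pats (D : dialgebra) (a b c : D) : D :=
  a ⊣ b ⊣ c - a ⊣ c ⊣ b - b ⊢ a ⊣ c
  + c ⊢ a ⊣ b + b ⊢ c ⊢ a - c ⊢ b ⊢ a.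

Section PatsTernary.
Variable D : dialgebra.

Let scalerBD (k : rat) (a1 a2 a3 a4 a5 a6 b1 b2 b3 b4 b5 b6 : D) :
  k *: a1 + b1 - (k *: a2 + b2) - (k *: a3 + b3) + (k *: a4 + b4)
  + (k *: a5 + b5) - (k *: a6 + b6)
  = k *: (a1 - a2 - a3 + a4 + a5 - a6) + (b1 - b2 - b3 + b4 + b5 - b6).
Proof.
rewrite !(scalerDr, scalerN) !opprD.
move: (k *: a1) (k *: a2) (k *: a3) (k *: a4) (k *: a5) (k *: a6).
move=> x1 x2 x3 x4 x5 x6.
rewrite (addrACA x1) (addrACA (x1 - x2)) (addrACA (x1 - x2 - x3)).
by rewrite (addrACA (x1 - x2 - x3 + x4)) (addrACA (x1 - x2 - x3 + x4 + x5)).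
Qed.

Fact pats_linear1 (b c : D) : linear (fun a => pats a b c).
Proof.
by move=> k x y; rewrite /pats !(linearPl, linearPr) scalerBD.
Qed.

Fact pats_linear2 (a c : D) : linear (fun b => pats a b c).
Proof.
by move=> k x y; rewrite /pats !(linearPl, linearPr) scalerBD.
Qed.

Fact pats_linear3 (a b : D) : linear (fun c => pats a b c).
Proof.
by move=> k x y; rewrite /pats !(linearPl, linearPr) scalerBD.
Qed.

Definition pats_algebra : ternaryAlgebra :=
  TernaryAlgebra pats_linear1 pats_linear2 pats_linear3.

End PatsTernary.

Inductive tmonomial (X : Type) : Type :=
  | TVar of X
  | TProd of tmonomial X & tmonomial X & tmonomial X.

Section TMonomialChoice.
Variable X : Type.

Fixpoint tmonomial_encode (m : tmonomial X) : GenTree.tree X :=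
  match m with
  | TVar x => GenTree.Leaf x
  | TProd m1 m2 m3 =>
      GenTree.Node 0 [:: tmonomial_encode m1; tmonomial_encode m2;
                         tmonomial_encode m3]
  end.

Fixpoint tmonomial_decode (t : GenTree.tree X) : option (tmonomial X) :=
  match t with
  | GenTree.Leaf x => Some (TVar x)
  | GenTree.Node _ [:: t1; t2; t3] =>
      if tmonomial_decode t1 is Some m1 then
        if tmonomial_decode t2 is Some m2 then
          if tmonomial_decode t3 is Some m3 then Some (TProd m1 m2 m3)
          else None
        else None
      else None
  | _ => None
  end.

Fact tmonomial_encodeK : pcancel tmonomial_encode tmonomial_decode.
Proof. by elim=> //= m1 -> m2 -> m3 ->. Qed.

End TMonomialChoice.

HB.instance Definition _ (X : choiceType) :=
  Choice.copy (tmonomial X) (pcan_type (@tmonomial_encodeK X)).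

Fixpoint tvars (X : Type) (m : tmonomial X) : seq X :=
  match m with
  | TVar x => [:: x]
  | TProd m1 m2 m3 => tvars m1 ++ tvars m2 ++ tvars m3
  end.

(* The underlying space of the free ternary algebra on X. *)
Notation tpoly X := {freeg (tmonomial X) / rat}.

(* The polynomials in exactly the n variables indexed by 'I_n, each occurring
   once in every monomial of the support; such a polynomial has degree n (the
   zero polynomial is multilinear for every n). *)
Definition multilinear (n : nat) (f : tpoly 'I_n) : Prop :=
  forall m, m \in dom f -> perm_eq (tvars m) (enum 'I_n).

Fixpoint tmonomial_eval (X : Type) (T : ternaryAlgebra) (v : X -> T)
    (m : tmonomial X) : T :=
  match m with
  | TVar x => v x
  | TProd m1 m2 m3 =>
      tprod (tmonomial_eval v m1) (tmonomial_eval v m2) (tmonomial_eval v m3)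
  end.

Definition tpoly_eval (X : choiceType) (T : ternaryAlgebra) (v : X -> T)
    (f : tpoly X) : T :=
  fglift (tmonomial_eval v) f.

Definition satisfies (T : ternaryAlgebra) (X : choiceType) (f : tpoly X) : Prop :=
  forall v : X -> T, tpoly_eval v f = 0.

Definition satisfied_by_pats (X : choiceType) (f : tpoly X) : Prop :=
  forall D : dialgebra, satisfies (pats_algebra D) f.

Definition consequence (Y X : choiceType) (I : seq (tpoly Y)) (f : tpoly X) : Prop :=
  forall T : ternaryAlgebra, (forall p, p \in I -> satisfies T p) -> satisfies T f.

Section Identities.

(* The variables a, b, c, d, e, f, g are the seven elements of 'I_7; P and Q
   only involve the first three and the first five of them. *)
Local Notation a := (@Ordinal 7 0 isT).
Local Notation b := (@Ordinal 7 1 isT).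
Local Notation c := (@Ordinal 7 2 isT).
Local Notation d := (@Ordinal 7 3 isT).
Local Notation e := (@Ordinal 7 4 isT).
Local Notation f := (@Ordinal 7 5 isT).
Local Notation g := (@Ordinal 7 6 isT).

Local Coercion var (i : 'I_7) : tmonomial 'I_7 := TVar i.
Local Notation "[t x , y , z ]" := (TProd x y z)
  (at level 0, x at level 9, y at level 9, z at level 9).

(* S_6 and S_5 are the groups of permutations of the seven variables whose
   support lies in A, and the image of the variable x under s is s x. *)
Definition alternating_sum (A : {set 'I_7})
    (m : {perm 'I_7} -> tmonomial 'I_7) : tpoly 'I_7 :=
  \sum_(s : {perm 'I_7} | perm_on A s) << (-1) ^+ s *g m s >>.

Definition ident_P : tpoly 'I_7 := << [t a, b, c] >> + << [t a, c, b] >>.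

Definition ident_Q : tpoly 'I_7 :=
  << [t a, [t b, c, d], e] >> + << [t a, [t c, b, d], e] >>.

Definition ident_R : tpoly 'I_7 :=
  let alt := alternating_sum [set b; c; d; e; f; g] in
  12^-1 *: alt (fun s => [t [t a, [t (s b), (s c), (s d)], (s e)], (s f), (s g)])
  - 12^-1 *: alt (fun s => [t [t a, (s b), (s c)], [t (s d), (s e), (s f)], (s g)]).

Definition ident_S : tpoly 'I_7 :=
  let alt := alternating_sum [set b; c; d; e; f] in
  4^-1 *: alt (fun s => [t [t [t a, (s b), (s c)], (s d), g], (s e), (s f)])
  - 6^-1 *: alt (fun s => [t [t a, [t (s b), (s c), (s d)], (s e)], (s f), g])
  + 4^-1 *: alt (fun s => [t [t a, [t (s b), (s c), g], (s d)], (s e), (s f)])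
  + 12^-1 *: alt (fun s => [t [t a, (s b), (s c)], [t (s d), (s e), (s f)], g])
  - 6^-1 *: alt (fun s => [t a, [t [t (s b), (s c), (s d)], (s e), g], (s f)])
  - 12^-1 *: alt (fun s => [t a, [t (s b), (s c), (s d)], [t (s e), (s f), g]]).

End Identities.

(* Main.v *)
(* In the free dialgebra on X, whose basis consists of the words in X with one
   marked letter, the PATS sends a ternary monomial to a signed sum of words.  If
   a ternary algebra T satisfies P, Q, R and S, this image determines the value
   in T of every monomial m with at most seven leaves: there is a linear map Phi
   from the free dialgebra to T which takes the image of m to a non-zero multiple,
   depending only on the degree, of the value of m.  So a combination of monomials
   of the same degree that is killed by the PATS is killed by T.

   On the words of length 1, 3, 5 and 7, Phi is a fixed combination of ternary
   monomials in the letters, rearranged as if the product were alternating to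
   bring the marked letter to the front.  Its coefficients were found by solving
   a sparse linear system.  By naturality they need only be verified on the 17
   bracketings of one, three, five or seven distinct variables.  P and Q suffice
   for this, except on the three bracketings of degree seven in which two of the
   three outermost factors are products: there, instances of R and S are needed. *)
From HB Require Import structures.
From Stdlib Require Import ZArith.
Require Import Defs.
From mathcomp Require Import all_boot all_order all_algebra all_fingroup.
From mathcomp Require Import zify ssrZ sesquilinear.
From mathcomp.multinomials Require Import freeg.

Set Implicit Arguments.
Unset Strict Implicit.
Unset Printing Implicit Defensive.

Import GRing.Theory.
Local Open Scope ring_scope.

(** * Linear maps and free modules *)

Section LinearFunctions.

Variables (R : nzRingType) (U V : lmodType R) (f : U -> V).
Hypothesis f_linear : linear f.

Let g : {linear U -> V} :=
  HB.pack f (GRing.isLinear.Build R U V *:%R f f_linear).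

(** The products of a ternary algebra and the maps [fglift f] come with a bare proof of [linear];
    these lemmas give them the usual rules for linear morphisms. *)
Lemma linear_fun_sum (I : Type) (r : seq I) (P : pred I) (F : I -> U) :
  f (\sum_(i <- r | P i) F i) = \sum_(i <- r | P i) f (F i).
Proof. exact: (linear_sum g). Qed.

Lemma linear_funZ a x : f (a *: x) = a *: f x.
Proof. by rewrite -[f]/(g : U -> V) linearZ. Qed.

Lemma linear_funN x : f (- x) = - f x.
Proof. exact: (linearN g). Qed.

Lemma linear_funD x y : f (x + y) = f x + f y.
Proof. exact: (linearD g). Qed.

End LinearFunctions.

Section FreeModule.

Variables (K : choiceType) (V : lmodType rat).
Implicit Types (f g : K -> V) (D : {freeg K / rat}).

Let lift f : {additive {freeg K / rat} -> V} :=
  HB.pack (fglift f) (GRing.isZmodMorphism.Build _ _ _ (lift_is_additive f)).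

Lemma fgliftE f D : fglift f D = \sum_(x <- dom D) coeff x D *: f x.
Proof.
rewrite -{1}[D]freeg_sumE.
rewrite -[fglift f _]/(lift f _) raddf_sum.
by apply: eq_bigr => x _; apply: liftU.
Qed.

Lemma eq_fglift f g : f =1 g -> fglift f =1 fglift g.
Proof. by move=> fg D; rewrite !fgliftE; apply: eq_bigr => x _; rewrite fg. Qed.

Lemma fglift_linear f : linear (fglift f).
Proof.
move=> a D E; rewrite -[fglift f]/(lift f : _ -> _) raddfD; congr (_ + _).
rewrite [a *: D]/(fgscale a D) raddf_sum (fgliftE f D : lift f D = _)
  scaler_sumr.
by apply: eq_bigr => x _; rewrite scalerA; apply: liftU.
Qed.

Lemma fglift_fun_linear D (F : V -> K -> V) :
  (forall x, linear (F^~ x)) -> linear (fun u => fglift (F u) D).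
Proof.
move=> lF a u w; rewrite !fgliftE scaler_sumr -big_split /=.
by apply: eq_bigr => x _; rewrite lF scalerDr !scalerA mulrC.
Qed.

Lemma fgliftU1 f x : fglift f << x >> = f x.
Proof. by rewrite liftU scale1r. Qed.

End FreeModule.

Section FreeMultiplication.

Variable K : choiceType.
Local Notation F := {freeg K / rat}.

Definition fgmul (op : K -> K -> K) (a b : F) : F :=
  fglift (fun u => fglift (fun v => << op u v >> : F) b) a.

Variable op : K -> K -> K.

Fact fgmul_bilinear : bilinear_for *:%R *:%R (fgmul op).
Proof.
split=> b; first exact: fglift_linear.
apply: (fglift_fun_linear b (F := fun c u => fglift _ c)) => u.
exact: fglift_linear.
Qed.

HB.instance Definition _ := bilinear_isBilinear.Build rat F F F *:%R *:%R
  (fgmul op) fgmul_bilinear.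

Lemma fgmulU u v : fgmul op << u >> << v >> = << op u v >>.
Proof. by rewrite /fgmul !fgliftU1. Qed.

End FreeMultiplication.

Section FreeMultiplicationTriples.

Variable K : choiceType.
Local Notation F := {freeg K / rat}.
Implicit Types (a b c : F) (op : K -> K -> K).

(** A common form for both bracketings of a triple product, so that an axiom for three arguments
    reduces to one for three basis elements. *)
Definition fglift3 (h : K -> K -> K -> K) a b c : F :=
  fglift (fun u => fglift (fun v => fglift (fun w => << h u v w >> : F) c) b) a.

Lemma eq_fglift3 h h' a b c :
  (forall u v w, h u v w = h' u v w) -> fglift3 h a b c = fglift3 h' a b c.
Proof. by move=> hh; do 3!apply: eq_fglift => ?; rewrite hh. Qed.

Lemma fglift_fglift (V : lmodType rat) (f : K -> V) (g : K -> F) a :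
  fglift f (fglift g a) = fglift (fun u => fglift f (g u)) a.
Proof.
rewrite !(fgliftE _ a) (linear_fun_sum (fglift_linear f)).
by apply: eq_bigr => u _; rewrite (linear_funZ (fglift_linear f)).
Qed.

Lemma fgmul_fgmull op op' a b c :
  fgmul op (fgmul op' a b) c = fglift3 (fun u v w => op (op' u v) w) a b c.
Proof.
rewrite /fgmul fglift_fglift; apply: eq_fglift => u.
by rewrite fglift_fglift; apply: eq_fglift => v; rewrite fgliftU1.
Qed.

Lemma fgmul_fgmulr op op' a b c :
  fgmul op a (fgmul op' b c) = fglift3 (fun u v w => op u (op' v w)) a b c.
Proof.
apply: eq_fglift => u; rewrite fglift_fglift; apply: eq_fglift => v.
by rewrite fglift_fglift; apply: eq_fglift => w; rewrite fgliftU1.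
Qed.

End FreeMultiplicationTriples.

(** * The PATS in the free dialgebra *)

(* The word l ++ c :: r with marked letter c is (l, c, r). *)
Local Notation word X := (seq X * X * seq X)%type.

Definition letters (X : Type) (w : word X) := w.1.1 ++ w.1.2 :: w.2.

(* A pair (s, w) stands for the word w with sign (-1) ^+ s. *)
Definition pats_words (X : Type) (e1 e2 e3 : bool * word X) :
    seq (bool * word X) :=
  let: (s1, (l, c, r)) := e1 in
  let: (s2, u) := (e2.1, letters e2.2) in
  let: (s3, v) := (e3.1, letters e3.2) in
  let s := s1 (+) (s2 (+) s3) in
  [:: (s, (l, c, r ++ u ++ v)); (~~ s, (l, c, r ++ v ++ u));
      (~~ s, (u ++ l, c, r ++ v)); (s, (v ++ l, c, r ++ u));
      (s, (u ++ v ++ l, c, r)); (~~ s, (v ++ u ++ l, c, r))].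

Fixpoint expand (X : Type) (m : tmonomial X) : seq (bool * word X) :=
  match m with
  | TVar x => [:: (false, ([::], x, [::]))]
  | TProd m1 m2 m3 =>
      flatten [seq flatten [seq pats_words e1 e2 e3
                              | e2 <- expand m2, e3 <- expand m3]
                 | e1 <- expand m1]
  end.

Section Expansion.

Variable X : Type.
Local Notation W := (word X).

Lemma pats_words_sign (V : lmodType rat) (G : W -> V) (e1 e2 e3 : bool * W) :
  \sum_(e <- pats_words e1 e2 e3) (-1) ^+ e.1 *: G e.2
  = ((-1) ^+ e1.1 * ((-1) ^+ e2.1 * (-1) ^+ e3.1)) *:
    \sum_(e <- pats_words (false, e1.2) (false, e2.2) (false, e3.2))
      (-1) ^+ e.1 *: G e.2.
Proof.
case: e1 e2 e3 => [s1 [[l c] r]] [s2 w2] [s3 w3].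
rewrite /pats_words !big_cons !big_nil /= !addr0 -!signr_addb.
by case: (s1 (+) _); rewrite /= !expr0 !expr1 ?scaleN1r ?scale1r ?opprD ?opprK.
Qed.

Lemma eval_expand (T : ternaryAlgebra) (G : W -> T) :
  (forall w1 w2 w3, tprod (G w1) (G w2) (G w3)
     = \sum_(e <- pats_words (false, w1) (false, w2) (false, w3))
         (-1) ^+ e.1 *: G e.2) ->
  forall m : tmonomial X,
  tmonomial_eval (fun x => G ([::], x, [::])) m
  = \sum_(e <- expand m) (-1) ^+ e.1 *: G e.2.
Proof.
move=> GM; elim=> [x|m1 IH1 m2 IH2 m3 IH3] /=.
  by rewrite big_seq1 expr0 scale1r.
rewrite IH1 IH2 IH3.
rewrite (linear_fun_sum (tprod_linear1 _ _)) big_flatten big_map.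
apply: eq_bigr => e1 _; rewrite (linear_fun_sum (tprod_linear2 _ _)).
rewrite big_flatten big_allpairs_dep; apply: eq_bigr => e2 _.
rewrite (linear_fun_sum (tprod_linear3 _ _)); apply: eq_bigr => e3 _.
rewrite pats_words_sign (linear_funZ (tprod_linear1 _ _)).
rewrite (linear_funZ (tprod_linear2 _ _)) (linear_funZ (tprod_linear3 _ _)).
by rewrite !scalerA GM; congr (_ *: _); rewrite mulrA.
Qed.

End Expansion.

Section FreeDialgebra.

Variable X : choiceType.
Local Notation W := (word X).
Implicit Types u v w : W.

Definition word_left u v : W := (u.1.1, u.1.2, u.2 ++ letters v).
Definition word_right u v : W := (letters u ++ v.1.1, v.1.2, v.2).

Lemma letters_left u v : letters (word_left u v) = letters u ++ letters v.
Proof. by rewrite /letters /= -catA. Qed.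

Lemma letters_right u v : letters (word_right u v) = letters u ++ letters v.
Proof. by rewrite /letters /= -!catA. Qed.

(** Both products concatenate the underlying words, and each sees only the letters of the factor
    whose mark it discards; this gives the two bar axioms. *)
Definition free_dialgebra : dialgebra.
Proof.
refine (@Dialgebra {freeg W / rat} (fgmul word_left) (fgmul word_right)
  _ _ _ _ _);
  move=> a b c; rewrite /= !(fgmul_fgmull, fgmul_fgmulr);
  apply: eq_fglift3 => u v w.
- by rewrite [RHS]/word_left letters_left catA.
- by rewrite [LHS]/word_right letters_right -catA.
- by [].
- by rewrite -[LHS]/(letters _ ++ w.1.1, w.1.2, w.2) letters_left -letters_right.
- by rewrite -[LHS]/(u.1.1, u.1.2, u.2 ++ letters _) letters_left -letters_right.
Defined.

Definition of_word (w : W) : pats_algebra free_dialgebra := << w >>.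

Definition generator (x : X) := of_word ([::], x, [::]).

(** In all six terms of the PATS the products point to the first argument: its mark survives, and
    [w2] and [w3] enter only through their letters. *)
Lemma pats_generators (w1 w2 w3 : W) :
  tprod (of_word w1) (of_word w2) (of_word w3)
  = \sum_(e <- pats_words (false, w1) (false, w2) (false, w3))
      (-1) ^+ e.1 *: of_word e.2.
Proof.
case: w1 => [[l c] r].
rewrite /pats_words !big_cons big_nil addr0 /= /pats /of_word /= !fgmulU.
rewrite /word_left /word_right /letters /= -!catA /= -?catA /=.
by rewrite expr0 expr1 !scale1r !scaleN1r !addrA.
Qed.

Lemma eval_generator (m : tmonomial X) :
  tmonomial_eval generator m = \sum_(e <- expand m) (-1) ^+ e.1 *: of_word e.2.
Proof.
exact: (@eval_expand X (pats_algebra free_dialgebra) of_word pats_generators m).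
Qed.

End FreeDialgebra.

(** * Relabelling the leaves of a monomial *)

Fixpoint tmap (X Y : Type) (f : X -> Y) (m : tmonomial X) : tmonomial Y :=
  match m with
  | TVar x => TVar (f x)
  | TProd m1 m2 m3 => TProd (tmap f m1) (tmap f m2) (tmap f m3)
  end.

(** With [k = 0] this is the generic monomial of the same shape, in distinct variables; by [labelK]
    every monomial is a relabelling of it. *)
Fixpoint label (X : Type) (k : nat) (m : tmonomial X) : tmonomial nat :=
  match m with
  | TVar _ => TVar k
  | TProd x y z =>
      let i := (k + size (tvars x))%N in
      let j := (i + size (tvars y))%N in
      TProd (label k x) (label i y) (label j z)
  end.

Fixpoint depth (X : Type) (m : tmonomial X) : nat :=
  match m with
  | TVar _ => 0%N
  | TProd x y z => (maxn (depth x) (maxn (depth y) (depth z))).+1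
  end.

Lemma size_tvars_gt0 (X : Type) (m : tmonomial X) : (0 < size (tvars m))%N.
Proof. by elim: m => //= m1 IH1 m2 _ m3 _; rewrite size_cat addn_gt0 IH1. Qed.

(** Each product on a longest branch adds at least two leaves beside the branch. *)
Lemma depth_tvars (X : Type) (m : tmonomial X) :
  ((depth m).*2 < size (tvars m))%N.
Proof.
elim: m => //= m1 IH1 m2 IH2 m3 IH3; rewrite !size_cat.
move: (size_tvars_gt0 m1) (size_tvars_gt0 m2) (size_tvars_gt0 m3); lia.
Qed.

Fixpoint shapes (d : nat) : seq (tmonomial unit) :=
  TVar tt ::
  if d is d'.+1 then
    let s := shapes d' in
    flatten [seq [seq TProd x y z | y <- s, z <- s] | x <- s]
  else [::].

Lemma mem_shapes d (m : tmonomial unit) : (depth m <= d)%N -> m \in shapes d.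
Proof.
elim: d m => [|d IH] [[]|x y z] //=; rewrite ltnS !geq_max => /and3P[xd yd zd].
rewrite in_cons; apply/orP; right; apply/flattenP.
exists [seq TProd x y' z' | y' <- shapes d, z' <- shapes d].
  by apply/mapP; exists x => //; apply: IH.
by apply/allpairsP; exists (y, z); split=> //; apply: IH.
Qed.

Section Relabelling.

Variables X Y : Type.

Lemma tvars_map (f : X -> Y) m : tvars (tmap f m) = map f (tvars m).
Proof. by elim: m => //= m1 -> m2 -> m3 ->; rewrite !map_cat. Qed.

Lemma depth_map (f : X -> Y) m : depth (tmap f m) = depth m.
Proof. by elim: m => //= m1 -> m2 -> m3 ->. Qed.

Lemma label_map (f : X -> Y) k m : label k (tmap f m) = label k m.
Proof.
elim: m k => //= m1 IH1 m2 IH2 m3 IH3 k.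
by rewrite IH1 IH2 IH3 !tvars_map !size_map.
Qed.

Lemma size_tvars_label k (m : tmonomial X) :
  size (tvars (label k m)) = size (tvars m).
Proof.
by elim: m k => //= m1 IH1 m2 IH2 m3 IH3 k; rewrite !size_cat IH1 IH2 IH3.
Qed.

(** The lists [s1] and [s2] serve the induction: the leaves of a factor form a middle segment of the
    leaves of the product. *)
Lemma labelK (x0 : X) s1 s2 m :
  tmap (nth x0 (s1 ++ tvars m ++ s2)) (label (size s1) m) = m.
Proof.
elim: m s1 s2 => [x|m1 IH1 m2 IH2 m3 IH3] s1 s2 /=.
  by rewrite nth_cat ltnn subnn.
congr TProd; first by rewrite -catA IH1.
  by rewrite -!catA catA -size_cat IH2.
by rewrite -!catA catA -size_cat catA -size_cat IH3.
Qed.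

Definition map_word (f : X -> Y) (w : word X) : word Y :=
  (map f w.1.1, f w.1.2, map f w.2).

Lemma letters_map f w : letters (map_word f w) = map f (letters w).
Proof. by rewrite /letters map_cat. Qed.

(** The expansion rearranges letters without ever comparing them. *)
Lemma expand_map f m :
  expand (tmap f m) = [seq (e.1, map_word f e.2) | e <- expand m].
Proof.
elim: m => //= m1 IH1 m2 IH2 m3 IH3; rewrite IH1 IH2 IH3 map_flatten -!map_comp.
congr flatten; apply: eq_map => e1 /=.
rewrite allpairs_mapl allpairs_mapr map_flatten map_allpairs.
congr flatten; apply: eq_allpairs => e2 e3.
case: e1 => [s1 [[l c] r]].
by rewrite /pats_words /= !letters_map /map_word /= !map_cat.
Qed.

Lemma tmap_nth_map (f : X -> Y) (c : X) (l : seq X) t :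
  tmap (nth (f c) (map f l)) t = tmap f (tmap (nth c l) t).
Proof.
elim: t => [i|t1 /= -> t2 -> t3 -> //] /=; congr TVar.
have [il|li] := ltnP i (size l); first exact: nth_map.
by rewrite !nth_default ?size_map.
Qed.

End Relabelling.

(** * Normal forms modulo P and Q *)

Local Notation "[t x , y , z ]" := (@TProd nat x%N y%N z%N)
  (at level 0, x at level 9, y at level 9, z at level 9).
Local Coercion leaf (i : nat) : tmonomial nat := TVar i.

Fixpoint tcmp (t u : tmonomial nat) : comparison :=
  match t, u with
  | TVar i, TVar j => Nat.compare i j
  | TVar _, TProd _ _ _ => Lt
  | TProd _ _ _, TVar _ => Gt
  | TProd t1 t2 t3, TProd u1 u2 u3 =>
      match tcmp t1 u1 with
      | Eq => match tcmp t2 u2 with Eq => tcmp t3 u3 | c => c end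
      | c => c
      end
  end.

Lemma tcmp_eq (t u : tmonomial nat) : tcmp t u = Eq -> t = u.
Proof.
elim: t u => [i|t1 IH1 t2 IH2 t3 IH3] [j|u1 u2 u3] //=.
  by move/PeanoNat.Nat.compare_eq ->.
case E1: tcmp => //; case E2: tcmp => // E3.
by rewrite (IH1 _ E1) (IH2 _ E2) (IH3 _ E3).
Qed.

Definition order2 (s : bool) (t u : tmonomial nat) :=
  if tcmp t u is Gt then (~~ s, (u, t)) else (s, (t, u)).

(* P and Q make the product alternating in any subtree that is not on the
   leftmost branch: all three factors may be sorted there, and only the last two
   on the leftmost branch. *)
Fixpoint norm_inner (t : tmonomial nat) : bool * tmonomial nat :=
  match t with
  | TVar _ => (false, t)
  | TProd x y z =>
      let: (s1, x) := norm_inner x in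
      let: (s2, y) := norm_inner y in
      let: (s3, z) := norm_inner z in
      let: (s, (x, y)) := order2 (s1 (+) (s2 (+) s3)) x y in
      let: (s, (y, z)) := order2 s y z in
      let: (s, (x, y)) := order2 s x y in
      (s, TProd x y z)
  end.

Fixpoint norm (t : tmonomial nat) : bool * tmonomial nat :=
  match t with
  | TVar _ => (false, t)
  | TProd x y z =>
      let: (s1, x) := norm x in
      let: (s2, y) := norm_inner y in
      let: (s3, z) := norm_inner z in
      let: (s, (y, z)) := order2 (s1 (+) (s2 (+) s3)) y z in
      (s, TProd x y z)
  end.

Definition signZ (s : bool) (z : Z) : Z := if s then Z.opp z else z.

Definition norm_term (p : Z * tmonomial nat) : Z * tmonomial nat :=
  let: (s, t) := norm p.2 in (signZ s p.1, t).

(** Here [z] is the running coefficient of the current monomial [t]; it has to be 0 whenever a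
    different monomial follows. *)
Fixpoint zero_sum_from (z : Z) (t : tmonomial nat) (l : seq (Z * tmonomial nat)) :=
  match l with
  | [::] => Z.eqb z 0
  | (z', t') :: l' =>
      match tcmp t t' with
      | Eq => zero_sum_from (Z.add z z') t l'
      | _ => Z.eqb z 0 && zero_sum_from z' t' l'
      end
  end.

Definition term_le (p q : Z * tmonomial nat) :=
  if tcmp p.2 q.2 is Gt then false else true.

Definition zero_sum (l : seq (Z * tmonomial nat)) :=
  zero_sum_from Z0 (leaf 0%N) (sort term_le (map norm_term l)).

Definition ratZ (z : Z) : rat := (int_of_Z z)%:~R.

Lemma ratZD y z : ratZ (Z.add y z) = ratZ y + ratZ z.
Proof. by rewrite /ratZ -intrD -(rmorphD int_of_Z). Qed.

Lemma ratZN z : ratZ (Z.opp z) = - ratZ z.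
Proof. by rewrite /ratZ -intrN -(rmorphN int_of_Z). Qed.

Lemma ratZM y z : ratZ (Z.mul y z) = ratZ y * ratZ z.
Proof. by rewrite /ratZ -intrM -(rmorphM int_of_Z). Qed.

Lemma ratZ_sign s z : ratZ (signZ s z) = (-1) ^+ s * ratZ z.
Proof. by case: s; rewrite /signZ ?expr0 ?expr1 ?mul1r // ratZN mulN1r. Qed.

Definition scale_terms (z : Z) (l : seq (Z * tmonomial nat)) :=
  [seq (Z.mul z q.1, q.2) | q <- l].

Section Evaluation.

Variable T : ternaryAlgebra.

Definition eval_terms (X : Type) (v : X -> T) (l : seq (Z * tmonomial X)) : T :=
  \sum_(q <- l) ratZ q.1 *: tmonomial_eval v q.2.

Lemma tmonomial_eval_map (X Y : Type) (f : X -> Y) (v : Y -> T) m :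
  tmonomial_eval v (tmap f m) = tmonomial_eval (v \o f) m.
Proof. by elim: m => //= m1 -> m2 -> m3 ->. Qed.

Lemma eval_terms_cat (X : Type) (v : X -> T) l1 l2 :
  eval_terms v (l1 ++ l2) = eval_terms v l1 + eval_terms v l2.
Proof. exact: big_cat. Qed.

Lemma eval_terms_sign (X : Type) (v : X -> T) s l :
  eval_terms v [seq (signZ s q.1, q.2) | q <- l] = (-1) ^+ s *: eval_terms v l.
Proof.
rewrite /eval_terms big_map scaler_sumr; apply: eq_bigr => q _.
by rewrite ratZ_sign scalerA.
Qed.

Lemma eval_scale_terms (v : nat -> T) z l :
  eval_terms v (scale_terms z l) = ratZ z *: eval_terms v l.
Proof.
rewrite /eval_terms big_map scaler_sumr; apply: eq_bigr => q _.
by rewrite ratZM scalerA.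
Qed.

Section ZeroSum.

Variable v : nat -> T.

Hypothesis tprodP : forall x y z : T, tprod x y z = - tprod x z y.
Hypothesis tprodQ : forall a b c d e : T,
  tprod a (tprod b c d) e = - tprod a (tprod c b d) e.

Local Notation ev := (tmonomial_eval v).

(** Equality up to sign as seen from an enclosing product. Reordering an inner subtree by Q may
    change its own value, but preserves this relation. *)
Definition inner_eq (s : bool) (t u : T) :=
  forall a b, tprod a t b = (-1) ^+ s *: tprod a u b.

Lemma inner_eq_right s t u : inner_eq s t u ->
  forall a b, tprod a b t = (-1) ^+ s *: tprod a b u.
Proof. by move=> tu a b; rewrite tprodP tu -scalerN -tprodP. Qed.

Lemma order2P (V : lmodType rat) (F : T -> T -> V) s t u s' t' u' :
  (forall x y : T, F x y = - F y x) ->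
  order2 s t u = (s', (t', u')) ->
  (-1) ^+ s *: F (ev t) (ev u) = (-1) ^+ s' *: F (ev t') (ev u').
Proof.
move=> FN; rewrite /order2; case: (tcmp t u) => [] [<- <- <-] //.
by rewrite FN signrN scalerN scaleNr.
Qed.

Lemma norm_innerP t s t' : norm_inner t = (s, t') -> inner_eq s (ev t) (ev t').
Proof.
elim: t s t' => [i|x IHx y IHy z IHz] s t' /=.
  by case=> <- <- a b; rewrite expr0 scale1r.
case Ex: norm_inner => [s1 x1]; case Ey: norm_inner => [s2 y1].
case Ez: norm_inner => [s3 z1].
case E4: order2 => [s4 [x2 y2]]; case E5: order2 => [s5 [y3 z2]].
case E6: order2 => [s6 [x3 y4]] [<- <-] a b /=.
have swap12 (e f g : T) : tprod a (tprod e f g) b = - tprod a (tprod f e g) b.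
  exact: tprodQ.
have swap23 (e f g : T) : tprod a (tprod e f g) b = - tprod a (tprod e g f) b.
  by rewrite (tprodP e f g) (linear_funN (tprod_linear2 _ _)).
(* The induction hypothesis concerns a middle factor, so [x] is swapped into the middle by Q,
   replaced, and swapped back. *)
have Fx (e f : T) : tprod a (tprod (ev x) e f) b
    = (-1) ^+ s1 *: tprod a (tprod (ev x1) e f) b.
  rewrite swap12 (IHx _ _ Ex) (linear_funZ (tprod_linear2 _ _)) -scalerN.
  by rewrite -swap12.
rewrite Fx (IHy _ _ Ey) (inner_eq_right (IHz _ _ Ez)).
rewrite !(linear_funZ (tprod_linear2 _ _)) !scalerA -!signr_addb.
rewrite (order2P (F := fun e f => tprod a (tprod e f (ev z1)) b) _ E4) //.
rewrite (order2P (F := fun e f => tprod a (tprod (ev x2) e f) b) _ E5) //.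
by rewrite (order2P (F := fun e f => tprod a (tprod e f (ev z2)) b) _ E6).
Qed.

(** On the leftmost branch the induction gives a true equality up to sign; for the other two factors
    [inner_eq] is enough, since they sit inside a product. *)
Lemma normP t s t' : norm t = (s, t') -> ev t = (-1) ^+ s *: ev t'.
Proof.
elim: t s t' => [i|x IHx y _ z _] s t' /=.
  by case=> <- <-; rewrite expr0 scale1r.
case Ex: norm => [s1 x1]; case Ey: norm_inner => [s2 y1].
case Ez: norm_inner => [s3 z1]; case E4: order2 => [s4 [y2 z2]] [<- <-] /=.
rewrite (IHx _ _ Ex) (linear_funZ (tprod_linear1 _ _)) (norm_innerP Ey).
rewrite (inner_eq_right (norm_innerP Ez)) !scalerA -!signr_addb.
exact: (order2P (F := fun e f => tprod (ev x1) e f) _ E4).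
Qed.

Lemma eval_norm_term l : eval_terms v (map norm_term l) = eval_terms v l.
Proof.
rewrite /eval_terms big_map; apply: eq_bigr => -[z t] _; rewrite /norm_term /=.
case E: norm => [s t'] /=.
by rewrite (normP E) ratZ_sign scalerA mulrC.
Qed.

Lemma zero_sum_fromP z t l :
  zero_sum_from z t l -> ratZ z *: ev t + eval_terms v l = 0.
Proof.
elim: l z t => [|[z' t'] l IH] z t /=.
  by move/Z.eqb_spec ->; rewrite /eval_terms big_nil scale0r addr0.
rewrite /eval_terms big_cons addrA /=.
have neq : Z.eqb z 0 && zero_sum_from z' t' l ->
    ratZ z *: ev t + ratZ z' *: ev t' + eval_terms v l = 0.
  by case/andP=> /Z.eqb_spec -> /IH; rewrite scale0r add0r.
case E: tcmp => //.
by rewrite -(tcmp_eq E) -scalerDl -ratZD => /IH.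
Qed.

Lemma zero_sumP l : zero_sum l -> eval_terms v l = 0.
Proof.
move/zero_sum_fromP; rewrite scale0r add0r => <-.
rewrite -eval_norm_term /eval_terms; apply/esym/perm_big.
by rewrite perm_sort.
Qed.

End ZeroSum.
End Evaluation.

(** * Alternating sums *)

(* A permutation supported in x :: l is s * (x y) for a unique s supported in l
   and a unique y in x :: l, so each one is listed once as a product. *)
Fixpoint transpositions (I : Type) (l : seq I) : seq (seq (I * I)) :=
  match l with
  | [::] => [:: [::]]
  | x :: l' => [seq (x, y) :: w | y <- l, w <- transpositions l']
  end.

(** A product of transpositions acting on plain numbers, which makes it computable; the head of the
    list acts last, as in [perm_of_word]. *)
Fixpoint act (w : seq (nat * nat)) (i : nat) : nat :=
  match w with
  | [::] => i
  | (x, y) :: w' =>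
      let j := act w' i in
      if Nat.eqb j x then y else if Nat.eqb j y then x else j
  end.

Fixpoint word_sign (w : seq (nat * nat)) : bool :=
  match w with
  | [::] => false
  | (x, y) :: w' => ~~ Nat.eqb x y (+) word_sign w'
  end.

Definition alternating_terms (l : seq nat) (q : Z)
    (M : (nat -> nat) -> tmonomial nat) : seq (Z * tmonomial nat) :=
  [seq (signZ (word_sign w) q, M (act w)) | w <- transpositions l].

Section AlternatingSums.

Variable I : finType.

Definition perm_of_word (w : seq (I * I)) : {perm I} :=
  foldr (fun p s => s * tperm p.1 p.2)%g 1%g w.

(** Permutations are grouped by the image [y] of [x]. Composing with the transposition of [x] and
    [y] makes [x] fixed, so the support shrinks to [A]. *)
Lemma sum_perm_on_cons (V : zmodType) (x : I) (A : {set I})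
    (F : {perm I} -> V) : x \notin A ->
  \sum_(s | perm_on (x |: A) s) F s
  = \sum_(y in x |: A) \sum_(s | perm_on A s) F (s * tperm x y)%g.
Proof.
move=> xA; rewrite (partition_big (fun s : {perm I} => s x) [in x |: A]) /=;
  last by move=> s sA; rewrite perm_closed // setU11.
apply: eq_bigr => y yA.
rewrite (reindex_inj (mulIg (tperm x y))) /=; apply: eq_bigl => s.
rewrite permM (can2_eq (tpermK x y) (tpermK x y)) tpermR.
apply/andP/idP => [[sA /eqP sx]|sA].
  apply/subsetP=> z; rewrite inE => sz.
  have zx : z != x by apply: contraNneq sz => ->; rewrite sx.
  have : perm_on (x |: A) s.
    rewrite -[s](mulgK (tperm x y)) tpermV; apply: perm_onM sA _.
    apply/subsetP=> u; rewrite inE; case: tpermP => [->|->|]; rewrite ?eqxx // => _.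
    by rewrite setU11.
  by move/subsetP/(_ z); rewrite inE sz in_setU1 (negPf zx) => /(_ isT).
split; last by rewrite (out_perm sA xA).
apply: perm_onM; first by apply: subset_trans sA (subsetUr _ _).
apply/subsetP=> u; rewrite inE; case: tpermP => [->|->|]; rewrite ?eqxx // => _.
by rewrite setU11.
Qed.

Lemma sum_perm_on (V : zmodType) (l : seq I) (F : {perm I} -> V) : uniq l ->
  \sum_(s | perm_on [set z in l] s) F s
  = \sum_(w <- transpositions l) F (perm_of_word w).
Proof.
elim: l F => [|x l IH] F.
  move=> _; rewrite big_seq1 (big_pred1 1%g) // => s.
  apply/idP/eqP => [s0|->]; last exact: perm_on1.
  by apply/permP=> z; rewrite (out_perm s0) ?perm1 // !inE.
move=> uxl; move: (uxl); rewrite cons_uniq => /andP[xl ul].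
rewrite set_cons sum_perm_on_cons ?inE // -set_cons.
rewrite -[transpositions _]/[seq (x, y) :: w | y <- x :: l,
                                               w <- transpositions l].
rewrite big_allpairs_dep big_uniq //=.
by apply: eq_big => [y|y _]; rewrite ?inE ?IH.
Qed.

End AlternatingSums.

Section AlternatingOrdinals.

Variable n : nat.

Let nat_pairs (w : seq ('I_n * 'I_n)) := [seq (val p.1, val p.2) | p <- w].

Lemma transpositions_val (l : seq 'I_n) :
  transpositions (map val l) = map nat_pairs (transpositions l).
Proof.
elim: l => // x l IH.
rewrite -[LHS]/[seq (val x, y) :: w | y <- map val (x :: l),
                                      w <- transpositions (map val l)].
rewrite -[transpositions (x :: l)]/[seq (x, y) :: w | y <- x :: l,
                                                     w <- transpositions l].
by rewrite IH allpairs_mapl allpairs_mapr map_allpairs.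
Qed.

Lemma perm_of_word_val w (i : 'I_n) :
  val (perm_of_word w i) = act (nat_pairs w) (val i).
Proof.
elim: w => [|[x y] w IH] /=; first by rewrite perm1.
rewrite permM -IH; set j := perm_of_word w i.
have eqbE (a b : 'I_n) : Nat.eqb a b = (a == b) by [].
rewrite !eqbE; case: tpermP => [->|->|/eqP/negPf -> /eqP/negPf -> //].
  by rewrite eqxx.
by rewrite eqxx; case: eqP => [->|].
Qed.

Lemma odd_perm_of_word w : perm_of_word w = word_sign (nat_pairs w) :> bool.
Proof.
elim: w => [|[x y] w IH] /=; first by rewrite odd_perm1.
by rewrite odd_permM IH odd_tperm addbC.
Qed.

End AlternatingOrdinals.

(** The bridge from sums over permutations to computable lists: [M] copies [m], with a function on
    numbers in place of the permutation. *)
Lemma eval_alternating_terms (T : ternaryAlgebra) (u : nat -> T) (a : rat)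
    (k : nat) (l : seq 'I_7) (A : {set 'I_7}) (m : {perm 'I_7} -> tmonomial 'I_7)
    (M : (nat -> nat) -> tmonomial nat) (q : Z) :
  map val l = iota 1 k -> uniq l -> A =i l -> ratZ q = a ->
  (forall (s : {perm 'I_7}) g, (forall i, val (s i) = g (val i)) ->
     tmonomial_eval (u \o val) (m s) = tmonomial_eval u (M g)) ->
  eval_terms u (alternating_terms (iota 1 k) q M)
  = a *: tpoly_eval (u \o val) (alternating_sum A m).
Proof.
move=> <- ul Al <- mM; rewrite /alternating_sum.
rewrite /tpoly_eval (linear_fun_sum (fglift_linear _)) scaler_sumr.
have -> : A = [set z in l] by apply/setP=> z; rewrite inE Al.
rewrite sum_perm_on // /eval_terms /alternating_terms transpositions_val !big_map.
apply: eq_bigr => w _; rewrite liftU scalerA odd_perm_of_word ratZ_sign mulrC /=.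
by rewrite (mM _ _ (perm_of_word_val w)).
Qed.

(** * The certificate *)

(** A middle factor comes forward by a transposition, hence the sign; a last factor by a 3-cycle,
    which is even. *)
Fixpoint center (p : nat) (t : tmonomial nat) : option (bool * tmonomial nat) :=
  match t with
  | TVar i => if Nat.eqb i p then Some (false, t) else None
  | TProd x y z =>
      if center p x is Some (s, x) then Some (s, TProd x y z)
      else if center p y is Some (s, y) then Some (~~ s, TProd y x z)
      else if center p z is Some (s, z) then Some (s, TProd z x y)
      else None
  end.

Definition center_term (p : nat) (q : Z * tmonomial nat) :=
  if center p q.2 is Some (s, t) then Some (signZ s q.1, t) else None.

Local Open Scope Z_scope.

(* [weights n] and [scale n] encode Phi on words of length [n] whose first letter
   is marked: the letter in position i replaces the leaf [i], and the result is
   to be divided by [scale n]. *)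
Definition weights7 : seq (Z * tmonomial nat) := [::
  (-56, [t 0, 1, [t 2, 6, [t 3, 4, 5]]]);
  (-58, [t 0, 1, [t 3, 6, [t 2, 4, 5]]]);
  (-8, [t 0, 3, [t 2, 6, [t 1, 4, 5]]]);
  (-44, [t 0, 4, [t 3, 6, [t 1, 2, 5]]]);
  (-2, [t 0, 5, [t 2, 4, [t 1, 3, 6]]]);
  (16, [t 0, 5, [t 3, 6, [t 1, 2, 4]]]);
  (6, [t 0, 5, [t 4, 6, [t 1, 2, 3]]]);
  (2, [t 0, 6, [t 1, 4, [t 2, 3, 5]]]);
  (34, [t 0, 6, [t 1, 5, [t 2, 3, 4]]]);
  (18, [t 0, [t 1, 2, 3], [t 4, 5, 6]]);
  (18, [t 0, [t 1, 2, 6], [t 3, 4, 5]]);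
  (-6, [t 0, [t 1, 4, 6], [t 2, 3, 5]]);
  (9, [t [t 0, 1, 2], 3, [t 4, 5, 6]]);
  (-18, [t [t 0, 1, 6], 2, [t 3, 4, 5]]);
  (18, [t [t 0, 3, 4], 5, [t 1, 2, 6]]);
  (15, [t [t 0, 3, 4], 6, [t 1, 2, 5]]);
  (-30, [t [t 0, 2, [t 1, 3, 5]], 4, 6]);
  (48, [t [t 0, 2, [t 1, 4, 6]], 3, 5]);
  (-16, [t [t [t 0, 2, 3], 1, 5], 4, 6]);
  (-10, [t [t [t 0, 2, 3], 4, 6], 1, 5]);
  (-110, [t [t [t 0, 2, 4], 1, 6], 3, 5]);
  (38, [t [t [t 0, 2, 4], 3, 6], 1, 5]);
  (74, [t [t [t 0, 3, 5], 1, 6], 2, 4]);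
  (-8, [t [t [t 0, 4, 5], 2, 3], 1, 6]);
  (-68, [t [t 0, 5, [t 1, 2, 3]], 4, 6]);
  (-2, [t [t 0, 5, [t 1, 2, 6]], 3, 4])].

Definition weights (n : nat) : seq (Z * tmonomial nat) :=
  match n with
  | 1%N => [:: (1, leaf 0%N)]
  | 3%N => [:: (1, [t 0, 1, 2])]
  | 5%N => [:: (-2, [t 0, 3, [t 1, 2, 4]]); (-3, [t 0, 4, [t 1, 2, 3]])]
  | 7%N => weights7
  | _ => [::]
  end.

Definition scale (n : nat) : Z :=
  match n with 3%N => 6 | 5%N => 36 | 7%N => 2160 | _ => 1 end.

(* Twelve times R and S, as lists of signed monomials. *)
Definition relation_R : seq (Z * tmonomial nat) :=
  let alt := alternating_terms (iota 1%N 6%N) in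
  alt 1 (fun s => [t [t 0, [t s 1, s 2, s 3], s 4], s 5, s 6])
  ++ alt (-1) (fun s => [t [t 0, s 1, s 2], [t s 3, s 4, s 5], s 6]).

Definition relation_S : seq (Z * tmonomial nat) :=
  let alt := alternating_terms (iota 1%N 5%N) in
  alt 3 (fun s => [t [t [t 0, s 1, s 2], s 3, 6], s 4, s 5])
  ++ alt (-2) (fun s => [t [t 0, [t s 1, s 2, s 3], s 4], s 5, 6])
  ++ alt 3 (fun s => [t [t 0, [t s 1, s 2, 6], s 3], s 4, s 5])
  ++ alt 1 (fun s => [t [t 0, s 1, s 2], [t s 3, s 4, s 5], 6])
  ++ alt (-2) (fun s => [t 0, [t [t s 1, s 2, s 3], s 4, 6], s 5])
  ++ alt (-1) (fun s => [t 0, [t s 1, s 2, s 3], [t s 4, s 5, 6]]).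

(* S with x in the role of g, with the sign making the six instances change
   only by the signature when b, ..., g are permuted. *)
Definition relation_S_at (x : nat) : seq (Z * tmonomial nat) :=
  [seq (signZ (~~ Nat.eqb x 6) q.1, tmap (act [:: (x, 6%N)]) q.2)
     | q <- relation_S].

Definition special_leaf (t : tmonomial nat) : option nat :=
  match t with
  | TProd (TVar x) (TProd _ _ _) (TProd _ _ _)
  | TProd (TProd _ _ _) (TVar x) (TProd _ _ _)
  | TProd (TProd _ _ _) (TProd _ _ _) (TVar x) => Some x
  | _ => None
  end.

(* Modulo P and Q, this is [scale 7] t minus Phi of the image of t.  It
   cannot be zero throughout: the PATS kills the span of the instances of R and S,
   on which this difference is therefore multiplication by [scale 7]. *)
Definition correction (t : tmonomial nat) : seq (Z * tmonomial nat) :=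
  if special_leaf t is Some x then
    scale_terms (-3)
      (relation_R ++ flatten [seq relation_S_at y | y <- iota 1%N 6%N])
    ++ (if x is 0%N then [::] else scale_terms 18 (relation_S_at x))
  else [::].

Local Close Scope Z_scope.

Definition centered_weights :=
  [seq [seq pmap (center_term p) (weights n) | p <- iota 0 n] | n <- iota 0 8].

(** Phi on one word, before division by [scale]. The marked letter is a convenient default for
    [nth], as [X] has no distinguished element. *)
Definition word_terms (X : Type) (w : word X) : seq (Z * tmonomial X) :=
  let l := letters w in
  [seq (q.1, tmap (nth w.1.2 l) q.2)
     | q <- nth [::] (nth [::] centered_weights (size l)) (size w.1.1)].

Definition image_terms (t : tmonomial nat) : seq (Z * tmonomial nat) :=
  flatten [seq [seq (signZ e.1 q.1, q.2) | q <- word_terms e.2] | e <- expand t].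

Definition check (t : tmonomial nat) : bool :=
  zero_sum ((Z.opp (scale (size (tvars t))), t) :: image_terms t ++ correction t).

(** By [depth_tvars], at most seven leaves force depth at most 3, so these are the 17
    bracketings. *)
Definition labelled_shapes :=
  [seq label 0 t | t <- shapes 3 & (size (tvars t) <= 7)%N].

Lemma scale_neq0 n : ratZ (scale n) != 0.
Proof. by rewrite intr_eq0; do 8?[case: n => [//|n]]. Qed.

Lemma check_labelled_shapes : all check labelled_shapes.
Proof. by vm_compute. Qed.

Section RelabellingWords.

Variables X Y : Type.

(** Relabelling preserves the length and the position of the mark, on which alone the coefficients
    depend. *)
Lemma word_terms_map (f : X -> Y) (w : word X) :
  word_terms (map_word f w) = [seq (q.1, tmap f q.2) | q <- word_terms w].
Proof.
rewrite /word_terms letters_map /= !size_map -map_comp; apply: eq_map => q /=.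
by rewrite tmap_nth_map.
Qed.

Lemma eval_terms_map (T : ternaryAlgebra) (v : Y -> T) (f : X -> Y) l :
  eval_terms v [seq (q.1, tmap f q.2) | q <- l] = eval_terms (v \o f) l.
Proof.
by rewrite /eval_terms big_map; apply: eq_bigr => q _; rewrite tmonomial_eval_map.
Qed.

End RelabellingWords.

(** * Phi in a ternary algebra satisfying P, Q, R and S *)

Section Consequences.

Variable T : ternaryAlgebra.
Hypothesis TP : satisfies T ident_P.
Hypothesis TQ : satisfies T ident_Q.
Hypothesis TR : satisfies T ident_R.
Hypothesis TS : satisfies T ident_S.

Lemma tpoly_evalD (X : choiceType) (v : X -> T) f g :
  tpoly_eval v (f + g) = tpoly_eval v f + tpoly_eval v g.
Proof. exact: (linear_funD (fglift_linear _)). Qed.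

Lemma tpoly_evalN (X : choiceType) (v : X -> T) f :
  tpoly_eval v (- f) = - tpoly_eval v f.
Proof. exact: (linear_funN (fglift_linear _)). Qed.

Lemma tpoly_evalZ (X : choiceType) (v : X -> T) a f :
  tpoly_eval v (a *: f) = a *: tpoly_eval v f.
Proof. exact: (linear_funZ (fglift_linear _)). Qed.

Lemma tpoly_evalU (X : choiceType) (v : X -> T) m :
  tpoly_eval v << m >> = tmonomial_eval v m.
Proof. exact: fgliftU1. Qed.

Lemma tprod_skew (x y z : T) : tprod x y z = - tprod x z y.
Proof.
(* The variables absent from P receive the default value [x]. *)
have := TP (fun i => nth x [:: x; y; z] i).
by rewrite tpoly_evalD !tpoly_evalU => /eqP; rewrite addr_eq0 => /eqP.
Qed.

Lemma tprod_inner_skew (a b c d e : T) :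
  tprod a (tprod b c d) e = - tprod a (tprod c b d) e.
Proof.
have := TQ (fun i => nth a [:: a; b; c; d; e] i).
by rewrite tpoly_evalD !tpoly_evalU => /eqP; rewrite addr_eq0 => /eqP.
Qed.

Local Notation o i := (@Ordinal 7 i isT).

Lemma eval_relation_R (u : nat -> T) : eval_terms u relation_R = 0.
Proof.
(* The factor 12 clears the denominators, matching [relation_R]. *)
have := congr1 ( *:%R 12%:R) (TR (u \o val)).
rewrite scaler0 tpoly_evalD tpoly_evalN !tpoly_evalZ scalerBr !scalerA.
rewrite -scaleNr => <-.
rewrite eval_terms_cat; congr (_ + _).
  apply: (eval_alternating_terms (l := [:: o 1; o 2; o 3; o 4; o 5; o 6])) => //.
    by move=> z; rewrite !inE -!orbA.
  by move=> s g E /=; rewrite !E.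
apply: (eval_alternating_terms (l := [:: o 1; o 2; o 3; o 4; o 5; o 6])) => //.
  by move=> z; rewrite !inE -!orbA.
by move=> s g E /=; rewrite !E.
Qed.

Lemma eval_relation_S (u : nat -> T) : eval_terms u relation_S = 0.
Proof.
have := congr1 ( *:%R 12%:R) (TS (u \o val)).
rewrite scaler0 !(tpoly_evalD, tpoly_evalN, tpoly_evalZ) !(scalerDr, scalerN).
rewrite !scalerA -!scaleNr => <-; rewrite !eval_terms_cat !addrA.
do 5?[congr (_ + _)];
  by apply: (eval_alternating_terms (l := [:: o 1; o 2; o 3; o 4; o 5])) => //;
    [move=> z; rewrite !inE -!orbA | move=> s g E /=; rewrite !E].
Qed.

Lemma eval_relation_S_at (u : nat -> T) x : eval_terms u (relation_S_at x) = 0.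
Proof.
rewrite /relation_S_at.
have -> : [seq (signZ (~~ Nat.eqb x 6) q.1, tmap (act [:: (x, 6%N)]) q.2)
            | q <- relation_S]
  = [seq (signZ (~~ Nat.eqb x 6) q.1, q.2)
       | q <- [seq (q.1, tmap (act [:: (x, 6%N)]) q.2) | q <- relation_S]].
  by rewrite -map_comp.
by rewrite eval_terms_sign eval_terms_map eval_relation_S scaler0.
Qed.

Lemma eval_correction (u : nat -> T) t : eval_terms u (correction t) = 0.
Proof.
have sum0 : eval_terms u
    (relation_R ++ flatten [seq relation_S_at x | x <- iota 1 6]) = 0.
  rewrite eval_terms_cat eval_relation_R add0r /eval_terms big_flatten big_map.
  by rewrite big1 // => x _; apply: eval_relation_S_at.
have nil0 : eval_terms u [::] = 0 by apply: big_nil.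
rewrite /correction; case: (special_leaf t) => [x|//].
rewrite eval_terms_cat eval_scale_terms sum0 scaler0 add0r.
by case: x => [//|x]; rewrite eval_scale_terms eval_relation_S_at scaler0.
Qed.

Lemma eval_image_nat (u : nat -> T) t : check t ->
  \sum_(e <- expand t) (-1) ^+ e.1 *: eval_terms u (word_terms e.2)
  = ratZ (scale (size (tvars t))) *: tmonomial_eval u t.
Proof.
move/(zero_sumP u tprod_skew tprod_inner_skew).
rewrite {1}/eval_terms big_cons -/(eval_terms u _) eval_terms_cat eval_correction.
rewrite addr0 ratZN scaleNr => /eqP; rewrite addrC subr_eq0 => /eqP <-.
rewrite /image_terms {2}/eval_terms big_flatten big_map.
by apply: eq_bigr => e _; rewrite -eval_terms_sign.
Qed.

(** Both sides are natural in the letters, so the case of the generic monomial, settled by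
    computation, implies the general one. *)
Lemma eval_image (X : Type) (v : X -> T) m : (size (tvars m) <= 7)%N ->
  \sum_(e <- expand m) (-1) ^+ e.1 *: eval_terms v (word_terms e.2)
  = ratZ (scale (size (tvars m))) *: tmonomial_eval v m.
Proof.
move=> m7; pose t := label 0 m.
(* Every monomial has a leaf, which supplies a default for [nth]. *)
have [x0 _] : exists x : X, True by elim: (m) => [x|_ [x _]]; exists x.
have mE : tmap (nth x0 (tvars m)) t = m.
  by rewrite -[RHS](labelK x0 [::] [::]) cats0.
have tC : check t.
  apply: (allP check_labelled_shapes); apply/mapP.
  exists (tmap (fun=> tt) m); last by rewrite label_map.
  rewrite mem_filter tvars_map size_map m7 mem_shapes // depth_map.
  by have := depth_tvars m; lia.
rewrite -(size_tvars_label 0 m) -/t; move: (nth _ _) mE => f <-.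
rewrite expand_map big_map tmonomial_eval_map -eval_image_nat //.
apply: eq_bigr => e _ /=.
by rewrite word_terms_map eval_terms_map.
Qed.

(** The value of [f] at the generators of the free dialgebra is 0, and Phi sends it to [scale n]
    times the value of [f] in [T]. Homogeneity makes this factor common to all monomials, so it
    cancels. *)
Lemma satisfies_homogeneous (X : choiceType) (n : nat) (f : tpoly X) :
  (n <= 7)%N -> (forall m, m \in dom f -> size (tvars m) = n) ->
  satisfied_by_pats f -> satisfies T f.
Proof.
move=> n7 fn f0 v.
pose Phi (D : free_dialgebra X) : T :=
  fglift (fun w => eval_terms v (word_terms w)) D.
have Phi_linear : linear Phi by apply: fglift_linear.
have : Phi (tpoly_eval (@generator X) f) = 0.
  by rewrite f0; have := linear_funZ Phi_linear 0 0; rewrite !scale0r.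
rewrite /tpoly_eval !fgliftE (linear_fun_sum Phi_linear) => Phi0.
apply: (scalerI (scale_neq0 n)); rewrite scaler0 scaler_sumr -[RHS]Phi0.
apply: eq_big_seq => m fm.
rewrite (linear_funZ Phi_linear) scalerA mulrC -scalerA.
congr (_ *: _); rewrite -(fn m fm) -eval_image ?fn // eval_generator.
rewrite (linear_fun_sum Phi_linear); apply: eq_bigr => e _.
by rewrite (linear_funZ Phi_linear) /Phi fgliftU1.
Qed.

End Consequences.

Local Close Scope ring_scope.

Theorem theorem6p3 (n : nat) (hn : n <= 7) (f : tpoly 'I_n)
    (hf : multilinear f) (hsat : satisfied_by_pats f) :
  consequence [:: ident_P; ident_Q; ident_R; ident_S] f.
Proof.
move=> T TI.
apply: (@satisfies_homogeneous T _ _ _ _ _ n) => //;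
  try by apply: TI; rewrite !inE eqxx ?orbT.
(* Each monomial of a multilinear polynomial in [n] variables has exactly [n] leaves. *)
by move=> m /hf/perm_size; rewrite size_enum_ord.
Qed.
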